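(* Let $m,n$ be coprime positive integers. Suppose $\pi$ is an $(m,n)$-Dyck path and let $(x,y)$ be a cell above the path $\pi$. The cell $(x,y)$ is in $\mathrm{Dinv}(\pi)$ if and only if $$\gamma[(x,y)^{\rightarrow}]>\gamma[(x,y)^{\Downarrow}]\qquad\text{and}\qquad \gamma[(x,y)^{\downarrow}]>\gamma[(x,y)^{\Rightarrow}].$$
   Context: Let $m,n$ be coprime positive integers. Diagram and paths. The $(m,n)$-lattice is the grid of unit squares (cells) filling the rectangle with southwest corner $(0,0)$ and northeast corner $(m,n)$. Cell $(u,v)$, $1\le u\le m$, $1\le v\le n$, is the unit square whose northeast corner is the point $(u,v)$; it lies in column $u$ and row $v$. Its rank is $\gamma(u,v)=mn-un-(n+1-v)m$ (distinct cells have distinct ranks). An $(m,n)$-Dyck path is a lattice path from $(0,0)$ to $(m,n)$ consisting of unit north and east steps and staying weakly above the diagonal $y=\frac{n}{m}x$. It splits the cells into those above the path (on its northwest side) and those below the path (on its southeast side). For a cell $(x,y)$ above $\pi$, $\mathrm{arm}(x,y)$ is the number of cells above $\pi$ in the same row strictly east of $(x,y)$, and $\mathrm{leg}(x,y)$ is the number of cells above $\pi$ in the same column strictly south of $(x,y)$. $\mathrm{Dinv}(\pi)$ is the set of cells $(x,y)$ above $\pi$ with $$\frac{\mathrm{arm}(x,y)}{\mathrm{leg}(x,y)+1}<\frac{m}{n}<\frac{\mathrm{arm}(x,y)+1}{\mathrm{leg}(x,y)}$$ (division by zero is interpreted as $\infty$). For a cell $(x,y)$ above $\pi$: $(x,y)^{\downarrow}$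 is the southernmost cell in the same column as $(x,y)$ that is above the path; $(x,y)^{\Downarrow}$ is the northernmost cell in the same column that is below the path; $(x,y)^{\rightarrow}$ is the easternmost cell in the same row as $(x,y)$ that is above the path; $(x,y)^{\Rightarrow}$ is the westernmost cell in the same row that is below the path. *)

(* Defs.v *)
(* MathComp *)
From mathcomp Require Import all_boot all_order all_algebra.

Set Implicit Arguments.
Unset Strict Implicit.
Unset Printing Implicit Defensive.

Import Order.TTheory GRing.Theory Num.Theory.

(* A lattice path from (0,0) is the sequence of its unit steps: [true] is a
   north step, [false] an east step.  [(path_x p i, path_y p i)] is the lattice
   point reached after the first [i] steps. *)
Definition path_x (p : seq bool) (i : nat) : nat := count_mem false (take i p).
Definition path_y (p : seq bool) (i : nat) : nat := count_mem true (take i p).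

(* Each step being a unit segment, the path stays weakly above the line as soon
   as the lattice points it visits do. *)
Definition dyck_path (m n : nat) (p : seq bool) : Prop :=
  [/\ count_mem false p = m,
      count_mem true p = n
    & forall i, i <= size p ->
        (n%:R / m%:R * (path_x p i)%:R <= (path_y p i)%:R :> rat)%R].

(* Ordinals count from 0, columns and rows from 1: the cell [c] has northeast
   corner [(col c, row c)]. *)
Definition cell (m n : nat) : finType := ('I_m * 'I_n)%type.

Section Cells.

Variables m n : nat.
Implicit Types (p : seq bool) (c d : cell m n).

Definition col c : nat := (c.1).+1.
Definition row c : nat := (c.2).+1.

Definition rank c : int :=
  (m%:Z * n%:Z - (col c)%:Z * n%:Z - (n%:Z + 1 - (row c)%:Z) * m%:Z)%R.

(* [c] is northwest of the path iff the path visits a lattice point weakly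
   southeast of [(col c, row c - 1)], the southeast corner of [c]. *)
Definition above p c : bool :=
  [exists i : 'I_(size p).+1, (col c <= path_x p i) && (path_y p i < row c)].

Definition below p c : bool := ~~ above p c.

Definition arm p c : nat :=
  #|[set d : cell m n | [&& above p d, row d == row c & col c < col d]]|.
Definition leg p c : nat :=
  #|[set d : cell m n | [&& above p d, col d == col c & row d < row c]]|.

(* Division by zero in [rat] yields 0, whereas here [(arm + 1) / 0] stands for
   infinity; hence the disjunction. *)
Definition Dinv p : {set cell m n} :=
  [set c | [&& above p c,
      ((arm p c)%:R / (leg p c + 1)%:R < m%:R / n%:R :> rat)%R
    & (leg p c == 0) ||
      (m%:R / n%:R < (arm p c + 1)%:R / (leg p c)%:R :> rat)%R]].

(* When no cell qualifies, the four functions below return [c] itself.  For [c]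
   above a Dyck path this does not happen: [c] qualifies for [south_above] and
   [east_above], see [below_col_ex] and [below_row_ex] for the other two. *)
Definition south_above p c : cell m n :=
  [arg min_(d < c | above p d && (col d == col c)) row d].
Definition north_below p c : cell m n :=
  [arg max_(d > c | below p d && (col d == col c)) row d].
Definition east_above p c : cell m n :=
  [arg max_(d > c | above p d && (row d == row c)) col d].
Definition west_below p c : cell m n :=
  [arg min_(d < c | below p d && (row d == row c)) col d].

Lemma dyck_path_le p i : 0 < m -> dyck_path m n p -> i <= size p ->
  n * path_x p i <= path_y p i * m.
Proof.
move=> m_gt0 [_ _ dyck] /dyck.
by rewrite mulrAC ler_pdivrMr ?ltr0n // -!natrM ler_nat.
Qed.

Lemma below_col_ex p c : dyck_path m n p ->
  exists d, below p d && (col d == col c).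
Proof.
move=> dyck; have m_gt0 : 0 < m by case: (c.1) => i /(leq_ltn_trans (leq0n _)).
have n_gt0 : 0 < n by case: (c.2) => i /(leq_ltn_trans (leq0n _)).
exists (c.1, Ordinal n_gt0); rewrite eqxx andbT.
apply/existsP => -[i /andP[xi]]; rewrite ltnS leqn0 => /eqP yi.
have := dyck_path_le m_gt0 dyck (ltn_ord i : i <= size p).
by rewrite yi mul0n leqNgt muln_gt0 n_gt0 (leq_trans _ xi).
Qed.

Lemma below_row_ex p c : dyck_path m n p ->
  exists d, below p d && (row d == row c).
Proof.
move=> dyck; have m_gt0 : 0 < m by case: (c.1) => i /(leq_ltn_trans (leq0n _)).
have lt_m : m.-1 < m by rewrite prednK.
exists (Ordinal lt_m, c.2); rewrite eqxx andbT.
apply/existsP => -[i /andP[]]; rewrite /col /row /= prednK // => xi yi.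
have := dyck_path_le m_gt0 dyck (ltn_ord i : i <= size p).
rewrite leqNgt => /negP; apply.
apply: leq_trans (leq_mul (leqnn n) xi).
by rewrite ltn_pmul2r // (leq_ltn_trans (yi : _ <= c.2)).
Qed.

End Cells.

(* Main.v *)
From mathcomp Require Import all_boot all_order all_algebra.
From mathcomp Require Import zify.
(* Imported last, so that [row] and [col] are the coordinates of a cell. *)
Require Import Defs.

(** Let [a] and [l] be the arm and the leg of the cell [c] = (x, y).  The cells
    above the path are closed under moving north or west ([above_nw]), so in
    the row of [c] they are exactly the cells west of [west_below p c], and in
    the column of [c] exactly the cells north of [north_below p c].  Counting
    the cells strictly between [c] and these boundary cells gives the positions
    of the four cells of the theorem: (x + a, y) and (x + a + 1, y) in the row,
    (x, y - l) and (x, y - l - 1) in the column.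

    The rank drops by [n] for each step east and by [m] for each step south.
    Comparing the ranks of (x + a, y) and (x, y - l - 1) therefore amounts to
    comparing [a n] with [(l + 1) m], and comparing those of (x, y - l) and
    (x + a + 1, y) to comparing [l m] with [(a + 1) n].  These are the two
    inequalities defining [Dinv] with denominators cleared. *)

Set Implicit Arguments.
Unset Strict Implicit.
Unset Printing Implicit Defensive.

Import Order.TTheory GRing.Theory Num.Theory.

Lemma card_ord_between k a b : b <= k ->
  #|[set i : 'I_k | a < i < b]| = b - a.+1.
Proof.
move=> le_bk; rewrite -sum1dep_card.
rewrite -(big_mkord (fun i => a < i < b) (fun=> 1)) -[RHS]muln1.
rewrite -sum_nat_const_nat (big_nat_widen _ _ _ _ _ le_bk).
by rewrite (big_nat_widenl a.+1 0) //; apply: eq_bigl => i; rewrite /= andbC.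
Qed.

(** [west_below p c] and [north_below p c] optimize over cells below the path,
    with default a cell above it.  The default of an optimum is irrelevant as
    soon as some element satisfies the predicate. *)
Lemma arg_minn_ex (T : finType) (i0 : T) (P : pred T) (F : T -> nat) :
  (exists i, P i) -> extremum_spec leq P F (arg_min i0 P F).
Proof.
move=> exP; have [w Pw w_min] := arg_minnP F (xchooseP exP).
rewrite /arg_min /extremum; case: pickP => [j /andP[Pj /forall_inP j_min]|none].
  by split.
by have := none w; rewrite /= Pw => /forall_inP[].
Qed.

Lemma arg_maxn_ex (T : finType) (i0 : T) (P : pred T) (F : T -> nat) :
  (exists i, P i) -> extremum_spec geq P F (arg_max i0 P F).
Proof.
move=> exP; have [w Pw w_max] := arg_maxnP F (xchooseP exP).
rewrite /arg_max /extremum; case: pickP => [j /andP[Pj /forall_inP j_max]|none].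
  by split.
by have := none w; rewrite /= Pw => /forall_inP[].
Qed.

Section Boundary.

Variables (m n : nat) (p : seq bool).
Implicit Types c d : cell m n.

(** The lattice point of the path that witnesses [above p c] also lies southeast
    of every cell northwest of [c]. *)
Lemma above_nw c d : above p c -> col d <= col c -> row c <= row d ->
  above p d.
Proof.
move=> /existsP[i /andP[le_cx lt_yc]] le_dc le_cd; apply/existsP; exists i.
by rewrite (leq_trans le_dc le_cx) (leq_trans lt_yc le_cd).
Qed.

Section Row.

Variable c : cell m n.
Hypothesis dyck : dyck_path m n p.

Lemma row_west_below : row (west_below p c) = row c.
Proof.
rewrite /west_below.
by case: (arg_minn_ex c _ (below_row_ex c dyck)) => w /andP[_ /eqP].
Qed.

(** [west_below p c] cuts its row in two: cells further west are above by
    minimality, and a cell above to its east would by [above_nw] put it above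
    the path as well. *)
Lemma above_row d : row d = row c -> above p d = (col d < col (west_below p c)).
Proof.
rewrite /west_below.
case: (arg_minn_ex c _ (below_row_ex c dyck)) => w.
case/andP=> w_below /eqP row_w w_min row_d; have [lt_dw|le_wd] := ltnP.
  apply: contraT => d_below; move: lt_dw; rewrite ltnNge w_min //.
  by rewrite /below d_below row_d eqxx.
apply: (contraNF _ w_below) => d_above.
by apply: (above_nw d_above); rewrite // row_w row_d.
Qed.

(** By [above_row] the cells counted by the arm are those strictly between [c]
    and [west_below p c]. *)
Lemma col_west_below : above p c -> col (west_below p c) = col c + arm p c + 1.
Proof.
move=> c_above; have: above p c by []; rewrite (above_row erefl).
have -> : arm p c = col (west_below p c) - (col c).+1.
  rewrite /arm; set w := west_below p c.
  have -> : [set d | [&& above p d, row d == row c & col c < col d]] =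
            [set (i, c.2) | i in [set i : 'I_m | c.1 < i < w.1]].
    apply/setP => d; apply/idP/imsetP => [|[i + ->]]; rewrite !inE.
      case/and3P=> d_above /eqP row_d lt_cd; exists d.1.
        by rewrite inE; apply/andP; split; rewrite // -[_ < _]above_row.
      by case: row_d => /val_inj <-; case: (d).
    by case/andP=> lt_ci lt_iw; rewrite above_row // !eqxx; apply/andP.
  rewrite card_imset; last by move=> i j [].
  by rewrite card_ord_between // ltnW.
lia.
Qed.

Lemma east_above_spec : above p c ->
  row (east_above p c) = row c /\ col (east_above p c) = col c + arm p c.
Proof.
move=> c_above; rewrite /east_above.
case: arg_maxnP => [|e /andP[e_above /eqP row_e] emax]; first by rewrite c_above /=.
split=> //; have lt_ew := e_above; rewrite above_row // in lt_ew.
have w_eq := col_west_below c_above.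
(* [Ordinal lt_m] is the column just west of [west_below p c]: its cell is
   above the path, hence a competitor for the maximum [e]. *)
have lt_m : c.1 + arm p c < m.
  by have := ltn_ord (west_below p c).1; move: w_eq; rewrite /col; lia.
have /emax : above p (Ordinal lt_m, c.2) && (row (Ordinal lt_m, c.2) == row c).
  by rewrite above_row // w_eq eqxx andbT /col /=; lia.
by move: lt_ew; rewrite w_eq /col /=; lia.
Qed.

End Row.

Section Column.

Variable c : cell m n.
Hypothesis dyck : dyck_path m n p.

Lemma col_north_below : col (north_below p c) = col c.
Proof.
rewrite /north_below.
by case: (arg_maxn_ex c _ (below_col_ex c dyck)) => w /andP[_ /eqP].
Qed.

Lemma above_col d : col d = col c ->
  above p d = (row (north_below p c) < row d).
Proof.
rewrite /north_below.
case: (arg_maxn_ex c _ (below_col_ex c dyck)) => w.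
case/andP=> w_below /eqP col_w w_max col_d; have [lt_wd|le_dw] := ltnP.
  apply: contraT => d_below; move: lt_wd; rewrite ltnNge; case/negP.
  by apply: w_max; rewrite /below d_below col_d eqxx.
apply: (contraNF _ w_below) => d_above.
by apply: (above_nw d_above); rewrite // col_w col_d.
Qed.

(** By [above_col] the cells counted by the leg are those strictly between
    [north_below p c] and [c]. *)
Lemma row_north_below : above p c -> row c = row (north_below p c) + leg p c + 1.
Proof.
move=> c_above; have: above p c by []; rewrite (above_col erefl).
have -> : leg p c = row c - (row (north_below p c)).+1.
  rewrite /leg; set w := north_below p c.
  have -> : [set d | [&& above p d, col d == col c & row d < row c]] =
            [set (c.1, i) | i in [set i : 'I_n | w.2 < i < c.2]].
    apply/setP => d; apply/idP/imsetP => [|[i + ->]]; rewrite !inE.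
      case/and3P=> d_above /eqP col_d lt_dc; exists d.2.
        by rewrite inE; apply/andP; split; rewrite // -[_ < _]above_col.
      by case: col_d => /val_inj <-; case: (d).
    by case/andP=> lt_wi lt_ic; rewrite above_col // !eqxx; apply/andP.
  rewrite card_imset; last by move=> i j [].
  by rewrite card_ord_between // ltnW.
lia.
Qed.

Lemma south_above_spec : above p c ->
  col (south_above p c) = col c /\ row c = row (south_above p c) + leg p c.
Proof.
move=> c_above; rewrite /south_above.
case: arg_minnP => [|s /andP[s_above /eqP col_s] s_min].
  by rewrite c_above /=.
split=> //; have lt_ws := s_above; rewrite above_col // in lt_ws.
have w_eq := row_north_below c_above.
(* [Ordinal lt_n] is the row just north of [north_below p c]: its cell is
   above the path, hence a competitor for the minimum [s]. *)
have lt_n : (north_below p c).2.+1 < n.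
  by have := ltn_ord c.2; move: w_eq; rewrite /row; lia.
have /s_min : above p (c.1, Ordinal lt_n) && (col (c.1, Ordinal lt_n) == col c).
  by rewrite above_col // eqxx andbT /row /=; lia.
by move: lt_ws; rewrite w_eq /row /=; lia.
Qed.

End Column.
End Boundary.

(** Clearing denominators also absorbs the convention at leg zero, where the
    second inequality becomes [0 < (arm + 1) n], which holds. *)
Lemma mem_Dinv m n (p : seq bool) (c : cell m n) : 0 < n ->
  (c \in Dinv m n p) =
  [&& above p c, arm p c * n < m * (leg p c + 1)
    & m * leg p c < (arm p c + 1) * n].
Proof.
move=> n_gt0; rewrite inE; congr [&& _, _ & _].
  rewrite ltr_pdivrMr ?ltr0n ?addn1 // mulrAC ltr_pdivlMr ?ltr0n //.
  by rewrite -!natrM ltr_nat.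
have [->|leg_gt0] := posnP (leg p c).
  by rewrite muln0 muln_gt0 addn1 n_gt0.
rewrite ltr_pdivrMr ?ltr0n // mulrAC ltr_pdivlMr ?ltr0n //.
by rewrite -!natrM ltr_nat.
Qed.

Theorem theorem5 (m n : nat) (m_gt0 : 0 < m) (n_gt0 : 0 < n)
  (co_mn : coprime m n) (p : seq bool) (p_dyck : dyck_path m n p)
  (c : cell m n) (c_above : above p c) :
  c \in Dinv m n p <->
    (rank (east_above p c) > rank (north_below p c))%R /\
    (rank (south_above p c) > rank (west_below p c))%R.
Proof.
have [row_e col_e] := east_above_spec p_dyck c_above.
have [col_s row_s] := south_above_spec p_dyck c_above.
have row_b := row_north_below p_dyck c_above.
have col_w := col_west_below p_dyck c_above.
rewrite mem_Dinv // c_above /rank row_e col_e col_s col_w.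
rewrite (row_west_below c p_dyck) (col_north_below c p_dyck).
have -> : row (south_above p c) = row (north_below p c) + 1 by lia.
rewrite row_b; split=> [/andP[lt1 lt2]|[lt1 lt2]]; last apply/andP; split; nia.
Qed.
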